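(* Let $\epsilon_1,\dots,\epsilon_n\in\{*,0,1,2,\dots\}$ be such that $(L_q^{\epsilon_1},\dots,L_q^{\epsilon_n})$ is a lattice word. Then $K^q_n(L_q^{\epsilon_1},\dots,L_q^{\epsilon_n})=0$ unless $\epsilon_1=\dots=\epsilon_{n-1}=*$ and $\epsilon_n=n-1$. In the latter case $$K^q_n(L_q^*,\dots,L_q^*,L_q^{n-1})=\rho\big(L_q^*L_q^*\cdots L_q^*L_q^{n-1}\big)=[n-1]_q!.$$
   Context: Fix $q$ with $-1\le q\le 1$. Let $\mathcal H$ be a complex Hilbert space with orthonormal basis $(e_i)_{i\ge0}$. On the algebraic full Fock space $\mathbb C\Omega\oplus\bigoplus_{n\ge1}\mathcal H^{\otimes n}$ define $P^q_n(\eta_1\otimes\cdots\otimes\eta_n)=\sum_{\sigma\in\mathfrak S_n}q^{\mathrm{inv}(\sigma)}\eta_{\sigma^{-1}(1)}\otimes\cdots\otimes\eta_{\sigma^{-1}(n)}$ ($\mathrm{inv}$ = number of inversions) and $\langle\xi,\eta\rangle_q=\delta_{m,n}\langle\xi,P_n^q\eta\rangle$ for $\xi\in\mathcal H^{\otimes m},\eta\in\mathcal H^{\otimes n}$; the $q$-Fock space $\mathcal F_q(\mathcal H)$ is the completion (after dividing out null vectors). Creation operators $L_q(\xi)\Omega=\xi$, $L_q(\xi)\eta_1\otimes\cdots\otimes\eta_n=\xi\otimes\eta_1\otimes\cdots\otimes\eta_n$; annihilation operators $L_q^*(\xi)\Omega=0$, $L^*_q(\xi)\eta_1\otimes\cdots\otimes\eta_n=\sum_{k=1}^nq^{k-1}\langle\xi,\eta_k\rangle\eta_1\otimes\cdots\widehat{\eta_k}\cdots\otimes\eta_n$.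 The state is $\rho(X)=\langle\Omega,X\Omega\rangle_q$. Let $L_q=L_q(e_0)$; for $X$ in the $*$-algebra generated by $L_q$ and $k\ge1$, $X^{(k)}$ is obtained by replacing $L_q(e_0)$ by $L_q(e_k)$ (and $L_q^*(e_0)$ by $L_q^*(e_k)$). For $\pi\in\Pi_n$ (set partitions of $[n]$, viewed as maps to block numbers) $\rho_\pi(X_1,\dots,X_n)=\rho(X_1^{(\pi(1))}\cdots X_n^{(\pi(n))})$, $K^q_\pi=\sum_{\sigma\le\pi}\rho_\sigma\mu(\sigma,\pi)$ ($\mu$ Möbius function of refinement order), $K^q_n=K^q_{\hat1_n}$. Notation: $L_q^0=I$, $L_q^*$ the adjoint, $L_q^k$ the power; $[m]_q=1+q+\dots+q^{m-1}$, $[m]_q!=[1]_q\cdots[m]_q$. Counting $*$ as $-1$, $(L_q^{\epsilon_1},\dots,L_q^{\epsilon_n})$ is a lattice word if $y_j=\epsilon_{j+1}+\dots+\epsilon_n\ge0$ for all $j$ and $y_0=0$. *)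

(* Defs.v *)
From HB Require Import structures.
From mathcomp Require Import classical_sets reals topology normedtype.
From mathcomp Require Import all_boot all_order all_fingroup all_algebra finmap.
From mathcomp Require Import sesquilinear complex.
From mathcomp Require Import zify.
From mathcomp Require Import -(notations) monalg.

Set Implicit Arguments.
Unset Strict Implicit.
Unset Printing Implicit Defensive.

Import Order.TTheory GRing.Theory Num.Theory.
Import numFieldNormedType.Exports.
Local Open Scope ring_scope.

Section Moebius.
Context {disp : Order.disp_t} {T : finPOrderType disp}.

Fixpoint moebius_rec (fuel : nat) (x y : T) : int :=
  if fuel is m.+1 then
    if x == y then 1
    else - \sum_(z | (x <= z)%O && (z < y)%O) moebius_rec m x z
  else 0.

(* Strict chains in T have at most #|T| elements, so the fuel never runs out;
   see moebiusxx and moebius_sum. *)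
Definition moebius (x y : T) : int := moebius_rec #|T| x y.

Lemma moebius_rec_fuel m k (x y : T) :
  (#|[set z : T | (z <= y)%O]| <= m)%N -> (#|[set z : T | (z <= y)%O]| <= k)%N ->
  moebius_rec m x y = moebius_rec k x y.
Proof.
have card_gt0 (z : T) : (0 < #|[set t : T | (t <= z)%O]|)%N.
  by apply/card_gt0P; exists z; rewrite inE.
elim: m k y => [|m IHm] [|k] y; rewrite ?leqn0 ?(gtn_eqF (card_gt0 _)) //= => ym yk.
case: eqP => // _; congr (- _); apply: eq_bigr => z /andP[_ zy].
have ltc : (#|[set t : T | (t <= z)%O]| < #|[set t : T | (t <= y)%O]|)%N.
  apply/proper_card/properP; split.
    by apply/subsetP => t; rewrite !inE => /le_trans; apply; exact: ltW.
  by exists y; rewrite !inE ?lexx // (lt_geF zy).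
by apply: IHm; rewrite -ltnS; exact: leq_trans ltc _.
Qed.

Lemma moebiusxx (x : T) : moebius x x = 1.
Proof.
rewrite /moebius; case E: #|T| => [|m] /=; last by rewrite eqxx.
by have := card0_eq E x.
Qed.

Lemma moebius_sum (x y : T) : (x < y)%O ->
  \sum_(z | (x <= z <= y)%O) moebius x z = 0.
Proof.
move=> xy; rewrite (bigD1 y) /=; last by rewrite (ltW xy) lexx.
rewrite {1}/moebius; case E: #|T| => [|m]; first by have := card0_eq E x.
rewrite /= (lt_eqF xy) addrC; apply/eqP; rewrite subr_eq0; apply/eqP.
apply: eq_big => [z|z /andP[/andP[xz zy] zNy]]; first by rewrite lt_neqAle -andbA [X in _ && X]andbC.
have {zy zNy} zy : (z < y)%O by rewrite lt_neqAle zNy.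
apply: moebius_rec_fuel; first exact: max_card.
rewrite -ltnS -E; apply: leq_trans (max_card [set t : T | (t <= y)%O]).
apply/proper_card/properP; split.
  by apply/subsetP => t; rewrite !inE => /le_trans; apply; exact: ltW.
by exists y; rewrite !inE ?lexx // (lt_geF zy).
Qed.

End Moebius.

Definition setpart (n : nat) : Type :=
  {P : {set {set 'I_n}} | partition P [set: 'I_n]}.

HB.instance Definition _ n := Finite.on (setpart n).

Definition refines n (s p : setpart n) : bool :=
  [forall A in val s, exists B in val p, A \subset B].

Lemma refinesP n (s p : setpart n) :
  reflect (forall A, A \in val s -> exists2 B, B \in val p & A \subset B)
          (refines s p).
Proof.
apply: (iffP forall_inP) => sp A /sp; first by move=> /exists_inP[B]; exists B.
by move=> [B Bp AB]; apply/exists_inP; exists B.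
Qed.

Lemma refines_refl n : reflexive (@refines n).
Proof. by move=> s; apply/refinesP => A As; exists A. Qed.

Lemma refines_trans n : transitive (@refines n).
Proof.
move=> t s p /refinesP st /refinesP tp; apply/refinesP => A /st[B /tp[D Dp BD] AB].
by exists D => //; exact: subset_trans BD.
Qed.

Lemma refines_anti n : antisymmetric (@refines n).
Proof.
have sub (s p : setpart n) : refines s p -> refines p s -> val s \subset val p.
  move=> /refinesP sp /refinesP ps; apply/subsetP => A As.
  have [B Bp AB] := sp A As; have [D Ds BD] := ps B Bp.
  have /and3P[_ ts s0] := valP s.
  have [x xA] : exists x, x \in A.
    by apply/set0Pn; apply: contraNneq s0 => <-.
  have xD : x \in D by apply: (subsetP BD); exact: (subsetP AB).
  have AD : A = D by rewrite -(def_pblock ts As xA) (def_pblock ts Ds xD).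
  suff -> : A = B by [].
  by apply/eqP; rewrite eqEsubset AB AD.
by move=> s p /andP[sp ps]; apply/val_inj/eqP; rewrite eqEsubset !sub.
Qed.

Fact setpart_display : Order.disp_t. Proof. exact: Order.Disp tt tt. Qed.

HB.instance Definition _ n := Order.Le_isPOrder.Build setpart_display (setpart n)
  (@refines_refl n) (@refines_anti n) (@refines_trans n).

Lemma le_setpartE n (s p : setpart n) : (s <= p)%O = refines s p.
Proof. by []. Qed.

Definition setpart1 n : setpart n :=
  exist (fun P => is_true (partition P [set: 'I_n]))
    (preim_partition (fun _ => tt) [set: 'I_n]) (preim_partitionP _ _).

Lemma setpart1E n : (0 < n)%N -> val (setpart1 n) = [set [set: 'I_n]].
Proof.
case: n => // n _; apply/setP => A; rewrite inE; apply/imsetP/eqP => [[i _ ->]|->].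
  by apply/setP => j; rewrite !inE.
by exists ord0 => //; apply/setP => j; rewrite !inE.
Qed.

(* The blocks are numbered from 1, in the order of their enumeration. *)
Definition block_number n (p : setpart n) (i : 'I_n) : nat :=
  (index (pblock (val p) i) (enum (val p))).+1.

Record hilbertSpace (R : realType) := HilbertSpace {
  hilbert_sort :> completeNormedModType R[i];
  hilbert_form : {dot hilbert_sort for (@Num.conj R[i])};
  hilbert_norm : forall x : hilbert_sort, `|x| ^+ 2 = hilbert_form x x }.

Section InnerProduct.
Context {R : realType} {H : hilbertSpace R}.

(* The inner product is linear in its second argument, whereas MathComp's dot
   forms are linear in the first one. *)
Definition inner (x y : H) : R[i] := hilbert_form H y x.

Definition orthonormal_basis (e : nat -> H) : Prop :=
  (forall i j, inner (e i) (e j) = (i == j)%:R) /\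
  topology_structure.closure [set x : H | exists n (c : 'I_n -> R[i]), x = \sum_i c i *: e i]%classic
    = [set: H]%classic.

End InnerProduct.

Definition inversions n (s : 'S_n) : nat :=
  #|[set ij : 'I_n * 'I_n | (ij.1 < ij.2)%N & (s ij.2 < s ij.1)%N]|.

Lemma inversionsE n (s : 'S_n) :
  inversions s = (\sum_(i < n) \sum_(j < n) ((i < j) && (s j < s i)))%N.
Proof.
rewrite pair_big /inversions -sum1dep_card big_mkcond /=.
by apply: eq_bigr => -[i j] _ /=; case: ifP.
Qed.

Lemma inversionsV n (s : 'S_n) : inversions (s^-1)%g = inversions s.
Proof.
rewrite !inversionsE exchange_big (reindex_inj (@perm_inj _ s)) /=.
apply: eq_bigr => i _; rewrite (reindex_inj (@perm_inj _ s)) /=.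
by apply: eq_bigr => j _; rewrite !permK andbC.
Qed.

Lemma inversions_lift n (k : 'I_n.+1) (t : 'S_n) :
  inversions (lift_perm ord0 k t) = (k + inversions t)%N.
Proof.
rewrite !inversionsE big_ord_recl /=; congr addn.
  rewrite big_ord_recl /= add0n lift_perm_id.
  rewrite (reindex_inj (@perm_inj _ (t^-1)%g)) /=.
  rewrite (eq_bigr (fun j : 'I_n => (j < k) : nat)); last first.
    move=> j _; rewrite lift_perm_lift permKV /= /bump; congr nat_of_bool.
    by case: (leqP k j) => kj; lia.
  rewrite -(big_mkord xpredT (fun j => (j < k) : nat)).
  have kn : (k <= n)%N by rewrite -ltnS.
  rewrite (big_cat_nat (leq0n k) kn) /= [X in (_ + X)%N]big_nat_cond.
  rewrite [X in (_ + X)%N]big1 => [|j /andP[/andP[kj _] _]]; last by rewrite ltnNge kj.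
  rewrite addn0 big_nat_cond (eq_bigr (fun=> 1%N)) => [|j /andP[/andP[_ ->]]] //.
  by rewrite -big_nat_cond sum_nat_const_nat subn0 muln1.
apply: eq_bigr => i _; rewrite big_ord_recl /= add0n.
apply: eq_bigr => j _; rewrite !lift_perm_lift /= /bump.
by congr nat_of_bool; case: (leqP k (t j)) => kj; case: (leqP k (t i)) => ki; lia.
Qed.

(* Formal linear combinations of words eta_1 ... eta_n over H, each standing for
   the elementary tensor eta_1 (x) ... (x) eta_n; the empty word is the vacuum.
   The multilinearity relations of the tensor powers lie in the kernel of the
   q-inner product (qinner_multilinear), so that dividing out its null vectors
   gives the same space as for tensors proper. The annihilation operator is the
   adjoint of the creation operator (qinner_annihilation) and both preserve the
   null vectors (creation_null, annihilation_null): vacuum expectations of their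
   products are the same before and after dividing out and completing. *)
Definition fock (R : realType) (H : hilbertSpace R) : lmodType R[i] :=
  malg (seq H) R[i].

Section Fock.
Context {R : realType} {H : hilbertSpace R}.
Implicit Types (xi : H) (u v w : seq H) (x y : fock H).

Definition tensor w : fock H := mkmalgU w 1.

Definition vacuum : fock H := tensor [::].

Definition lin_ext (V : lmodType R[i]) (f : seq H -> V) (x : fock H) : V :=
  \sum_(w <- msupp x) mcoeff w x *: f w.

Definition word_inner u v : R[i] :=
  if size u == size v then \prod_(i < size u) inner (nth 0 u i) (nth 0 v i)
  else 0.

Definition fock_inner x y : R[i] :=
  \sum_(u <- msupp x) \sum_(v <- msupp y)
    (mcoeff u x)^* * mcoeff v y * word_inner u v.

Lemma lin_extw (V : lmodType R[i]) (f : seq H -> V) x (d : {fset seq H}) :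
  fsubset (msupp x) d -> lin_ext f x = \sum_(w <- d) mcoeff w x *: f w.
Proof.
move=> sxd; rewrite /lin_ext [LHS](big_fset_incl _ sxd) // => w _ wx.
by rewrite mcoeff_outdom // scale0r.
Qed.

Lemma lin_ext_linear (V : lmodType R[i]) (f : seq H -> V) : linear (lin_ext f).
Proof.
move=> a x y; pose d := fsetU (msupp x) (msupp y).
rewrite !(@lin_extw _ _ _ d) ?fsubsetUl ?fsubsetUr //.
  rewrite scaler_sumr -big_split /=; apply: eq_bigr => w _.
  by rewrite mcoeffD mcoeffZ scalerDl scalerA.
apply: fsubset_trans (msuppD_le _ _) _; rewrite fsubUset fsubsetUr andbT.
exact: fsubset_trans (msuppZ_le _ _) (fsubsetUl _ _).
Qed.

HB.instance Definition _ (V : lmodType R[i]) (f : seq H -> V) :=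
  GRing.isLinear.Build R[i] (fock H) V _ (lin_ext f) (lin_ext_linear f).

Lemma lin_ext_tensor (V : lmodType R[i]) (f : seq H -> V) w :
  lin_ext f (tensor w) = f w.
Proof.
rewrite (@lin_extw _ _ _ [fset w]%fset) ?msuppU_le // big_seq_fset1.
by rewrite mcoeffUU scale1r.
Qed.

Lemma fock_tensorE x : x = \sum_(w <- msupp x) mcoeff w x *: tensor w.
Proof.
rewrite {1}[x]monalgE; apply: eq_bigr => w _; apply/malgP => v.
by rewrite mcoeffZ !mcoeffU mulr_natr.
Qed.

Lemma fock_innerE x y :
  fock_inner x y = \sum_(u <- msupp x)
    (mcoeff u x)^* * lin_ext (fun v => word_inner u v : R[i]^o) y.
Proof.
apply: eq_bigr => u _; rewrite mulr_sumr; apply: eq_bigr => v _.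
by rewrite mulrA.
Qed.

Lemma fock_inner_scalar x : scalar (fock_inner x).
Proof.
move=> a y z; rewrite !fock_innerE mulr_sumr -big_split /=.
apply: eq_bigr => u _; rewrite linearP mulrDr; congr (_ + _).
by rewrite mulrCA.
Qed.

Lemma fock_inner_tensorl u y :
  fock_inner (tensor u) y = lin_ext (fun v => word_inner u v : R[i]^o) y.
Proof.
rewrite fock_innerE msuppU oner_eq0 big_seq_fset1.
by rewrite mcoeffUU conjC1 mul1r.
Qed.

Lemma fock_inner_tensor u v : fock_inner (tensor u) (tensor v) = word_inner u v.
Proof. by rewrite fock_inner_tensorl lin_ext_tensor. Qed.

Lemma fock_inner_suml x y :
  fock_inner x y = \sum_(u <- msupp x) (mcoeff u x)^* * fock_inner (tensor u) y.
Proof. by rewrite fock_innerE; apply: eq_bigr => u _; rewrite fock_inner_tensorl. Qed.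

Lemma fock_inner_conj x y :
  fock_inner x y = (lin_ext (fun u => (fock_inner (tensor u) y)^* : R[i]^o) x)^*.
Proof.
rewrite fock_inner_suml rmorph_sum; apply: eq_bigr => u _.
by rewrite rmorphM /= conjCK.
Qed.

Lemma fock_inner_linearl a x y z :
  fock_inner (a *: x + y) z = a^* * fock_inner x z + fock_inner y z.
Proof. by rewrite !fock_inner_conj linearP rmorphD rmorphM. Qed.

Variable q : R.

Definition qsymm_word w : fock H :=
  \sum_(s : 'S_(size w)) q%:C%C ^+ inversions s *:
    tensor [seq nth 0 w ((s^-1)%g i) | i : 'I_(size w)].

Definition qsymm : fock H -> fock H := lin_ext qsymm_word.

Definition qinner x y : R[i] := fock_inner x (qsymm y).

Definition creation xi : fock H -> fock H :=
  lin_ext (fun w => tensor (xi :: w)).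

Definition annihilation xi : fock H -> fock H :=
  lin_ext (fun w => \sum_(k < size w)
    (q%:C%C ^+ k * inner xi (nth 0 w k)) *: tensor (take k w ++ drop k.+1 w)).

Definition rho (X : fock H -> fock H) : R[i] := qinner vacuum (X vacuum).

End Fock.

Section FockTheory.
Context {R : realType} {H : hilbertSpace R}.
Variable q : R.
Implicit Types (xi : H) (u v w : seq H) (x y : fock H).

Lemma qinner_scalar x : scalar (qinner q x).
Proof.
by move=> a y z; rewrite /qinner /qsymm linearP fock_inner_scalar.
Qed.

HB.instance Definition _ x :=
  GRing.isLinear.Build R[i] (fock H) R[i] *%R (qinner q x) (qinner_scalar x).

Lemma qinner_linearl a x y z :
  qinner q (a *: x + y) z = a^* * qinner q x z + qinner q y z.
Proof. exact: fock_inner_linearl. Qed.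

Lemma qinner0l z : qinner q (0 : fock H) z = 0.
Proof. by rewrite /qinner fock_innerE msupp0 big_seq_fset0. Qed.

Lemma qinnerDl x y z : qinner q (x + y) z = qinner q x z + qinner q y z.
Proof. by have := qinner_linearl 1 x y z; rewrite scale1r conjC1 mul1r. Qed.

Lemma qinnerZl a x z : qinner q (a *: x) z = a^* * qinner q x z.
Proof. by have := qinner_linearl a x 0 z; rewrite addr0 qinner0l addr0. Qed.

Lemma qinner_suml (I : Type) (r : seq I) (P : pred I) (F : I -> fock H) z :
  qinner q (\sum_(i <- r | P i) F i) z = \sum_(i <- r | P i) qinner q (F i) z.
Proof.
apply: (big_morph (fun x => qinner q x z)); last exact: qinner0l.
by move=> x y; exact: qinnerDl.
Qed.

Lemma qinner_tensor n u v : size u = n -> size v = n ->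
  qinner q (tensor u) (tensor v) =
  \sum_(s : 'S_n) q%:C%C ^+ inversions s *
    \prod_(i < n) inner (nth 0 u i) (nth 0 v (s i)).
Proof.
move=> + vn; case: _ / vn => {n} uv; rewrite /qinner /qsymm lin_ext_tensor.
rewrite fock_inner_tensorl linear_sum (reindex_inj invg_inj) /=.
apply: eq_bigr => s _; rewrite linearZ /= lin_ext_tensor inversionsV invgK.
rewrite /word_inner size_map size_enum_ord uv eqxx; congr (_ * _).
apply: eq_bigr => i _; congr inner.
by rewrite (nth_map i) ?size_enum_ord // nth_ord_enum.
Qed.

Lemma qinner_tensor0 u v : size u != size v -> qinner q (tensor u) (tensor v) = 0.
Proof.
move=> uv; rewrite /qinner /qsymm lin_ext_tensor fock_inner_tensorl linear_sum.
apply: big1 => s _; rewrite linearZ /= lin_ext_tensor /word_inner.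
by rewrite size_map size_enum_ord (negbTE uv) scaler0.
Qed.

Lemma innerC (xi eta : H) : inner xi eta = (inner eta xi)^*.
Proof. by rewrite /inner hermC expr0 mul1r. Qed.

Lemma conj_real : (q%:C%C)^* = q%:C%C :> R[i].
Proof. by apply/CrealP/complex_realP; exists q. Qed.

Lemma qinnerC_tensor u v :
  qinner q (tensor u) (tensor v) = (qinner q (tensor v) (tensor u))^*.
Proof.
have [uv|uv] := eqVneq (size u) (size v); last first.
  rewrite qinner_tensor0 // qinner_tensor0; first by rewrite conjC0.
  by rewrite eq_sym.
rewrite (@qinner_tensor (size v)) //.
rewrite (@qinner_tensor (size v) v u) //.
rewrite rmorph_sum (reindex_inj invg_inj) /=; apply: eq_bigr => s _.
rewrite inversionsV rmorphM rmorphXn /= conj_real rmorph_prod; congr (_ * _).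
rewrite (reindex_inj (@perm_inj _ s)) /=; apply: eq_bigr => i _.
by rewrite permK innerC.
Qed.

Lemma qinner_suml_tensor x y :
  qinner q x y = \sum_(u <- msupp x) (mcoeff u x)^* * qinner q (tensor u) y.
Proof.
by rewrite {1}[x]fock_tensorE qinner_suml; apply: eq_bigr => u _; rewrite qinnerZl.
Qed.

Lemma qinner_sumr_tensor x y :
  qinner q x y = \sum_(v <- msupp y) mcoeff v y * qinner q x (tensor v).
Proof.
by rewrite {1}[y]fock_tensorE linear_sum; apply: eq_bigr => u _; rewrite linearZ.
Qed.

Lemma qinnerC x y : qinner q x y = (qinner q y x)^*.
Proof.
rewrite qinner_suml_tensor [in RHS]qinner_sumr_tensor rmorph_sum.
apply: eq_bigr => u _; rewrite rmorphM /=; congr (_ * _).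
rewrite [in RHS]qinner_suml_tensor [LHS]qinner_sumr_tensor rmorph_sum.
by apply: eq_bigr => v _; rewrite rmorphM /= conjCK -qinnerC_tensor.
Qed.

Lemma qinner_multilinear a (xi eta : H) u v x :
  qinner q x (tensor (u ++ (a *: xi + eta) :: v)) =
  a * qinner q x (tensor (u ++ xi :: v)) + qinner q x (tensor (u ++ eta :: v)).
Proof.
rewrite !(qinner_suml_tensor x) mulr_sumr -big_split /=; apply: eq_bigr => w _.
rewrite mulrCA -mulrDr; congr (_ * _).
pose n := (size u + (size v).+1)%N.
have sz (z : H) : size (u ++ z :: v) = n by rewrite size_cat.
have [wn|wn] := eqVneq (size w) n; last first.
  by rewrite !qinner_tensor0 ?sz // mulr0 addr0.
rewrite !(qinner_tensor wn (sz _)) mulr_sumr -big_split /=.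
apply: eq_bigr => s _; rewrite mulrCA -mulrDr; congr (_ * _).
have un : (size u < n)%N by rewrite /n; lia.
pose k := (s^-1)%g (Ordinal un).
have E z : \prod_(i < n) inner (nth 0 w i) (nth 0 (u ++ z :: v) (s i)) =
    inner (nth 0 w k) z *
    \prod_(i < n | i != k) inner (nth 0 w i) (nth 0 (u ++ 0 :: v) (s i)).
  rewrite (bigD1 k) //= permKV /= nth_cat ltnn subnn /=; congr (_ * _).
  apply: eq_bigr => i ik; congr inner; rewrite !nth_cat.
  case: ltnP => // usi; case siu: (s i - size u)%N => [|//].
  case/eqP: ik; apply: (canRL (permK s)); apply/val_inj => /=; lia.
rewrite !E mulrA -mulrDl; congr (_ * _).
by rewrite /inner linearPl.
Qed.

Lemma qinnerZr a x y : qinner q x (a *: y) = a * qinner q x y.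
Proof. exact: linearZ. Qed.

Lemma qinner_sumr x (I : Type) (r : seq I) (P : pred I) (F : I -> fock H) :
  qinner q x (\sum_(i <- r | P i) F i) = \sum_(i <- r | P i) qinner q x (F i).
Proof. exact: linear_sum. Qed.

Lemma lin_ext_sum (V : lmodType R[i]) (f : seq H -> V) x :
  lin_ext f x = \sum_(w <- msupp x) mcoeff w x *: f w.
Proof. by []. Qed.

Lemma qinner_annihilation_tensor xi u v :
  qinner q (annihilation q xi (tensor u)) (tensor v) =
  qinner q (tensor u) (tensor (xi :: v)).
Proof.
rewrite /annihilation lin_ext_tensor.
have [un|un] := eqVneq (size u) (size v).+1; last first.
  rewrite [RHS]qinner_tensor0 //= qinner_suml big1 // => k _.
  rewrite qinnerZl qinner_tensor0 ?mulr0 // size_cat size_take size_drop ltn_ord.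
  by have := ltn_ord k; lia.
rewrite qinner_suml un (@qinner_tensor (size v).+1) //.
rewrite (partition_big (fun s : 'S_(size v).+1 => (s^-1)%g ord0) predT) //=.
apply: eq_bigr => k _.
have sz : size (take k u ++ drop k.+1 u) = size v.
  by rewrite size_cat size_take size_drop un ltn_ord; have := ltn_ord k; lia.
rewrite qinnerZl (@qinner_tensor (size v)) // mulr_sumr.
rewrite (reindex_inj invg_inj) [RHS](reindex_inj invg_inj) /=.
under [RHS]eq_bigl => s do rewrite invgK.
rewrite [RHS](reindex (lift_perm ord0 k)); last first.
  pose ulsf i (s : 'S_(size v).+1) j := odflt j (unlift (s i) (s (lift i j))).
  have ulsfK i (s : 'S_(size v).+1) j : lift (s i) (ulsf i s j) = s (lift i j).
    rewrite /ulsf; have := neq_lift i j.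
    by rewrite -(can_eq (permK s)) => /unlift_some[] ? ? ->.
  have inj_ulsf s : injective (ulsf ord0 s).
    apply: can_inj (ulsf (s ord0) s^-1%g) _ => j.
    by rewrite {1}/ulsf ulsfK !permK liftK.
  exists (fun s => perm (inj_ulsf s)) => [s _ | s].
    by apply/permP => j; rewrite permE /ulsf lift_perm_lift lift_perm_id liftK.
  move=> /(s _ =P _) si0; apply/permP => j.
  case: (unliftP ord0 j) => [j'|] ->; rewrite ?lift_perm_id //.
  by rewrite lift_perm_lift -si0 permE ulsfK.
apply: eq_big => [s|s _]; first by rewrite lift_perm_id eqxx.
rewrite !inversionsV inversions_lift exprD.
rewrite rmorphM rmorphXn /= conj_real -innerC -!mulrA; congr (_ * _).
rewrite mulrCA; congr (_ * _).
rewrite (bigD1_ord k) //= lift_permV lift_perm_id /=; congr (_ * _).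
apply: eq_bigr => i _.
rewrite lift_perm_lift /=; congr inner.
rewrite nth_cat size_take un ltn_ord /= /bump; case: ltnP => ki.
  by rewrite nth_take // leqNgt ki.
by rewrite nth_drop; congr nth; lia.
Qed.

Lemma qinner_annihilation xi x y :
  qinner q (annihilation q xi x) y = qinner q x (creation xi y).
Proof.
rewrite /annihilation lin_ext_sum qinner_suml [RHS]qinner_suml_tensor.
apply: eq_bigr => u _; rewrite qinnerZl.
rewrite /creation lin_ext_sum qinner_sumr [in LHS]qinner_sumr_tensor.
rewrite !mulr_sumr; apply: eq_bigr => v _; rewrite qinnerZr.
by rewrite -qinner_annihilation_tensor /annihilation lin_ext_tensor.
Qed.

Lemma creation_null xi x : (forall y, qinner q y x = 0) ->
  forall y, qinner q y (creation xi x) = 0.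
Proof. by move=> x0 y; rewrite -qinner_annihilation. Qed.

Lemma annihilation_null xi x : (forall y, qinner q y x = 0) ->
  forall y, qinner q y (annihilation q xi x) = 0.
Proof. by move=> x0 y; rewrite qinnerC qinner_annihilation -qinnerC. Qed.

End FockTheory.

(* Elements of the *-algebra generated by an operator and its adjoint, written
   as *-polynomials in that operator. *)
Inductive star_poly (K : Type) :=
  | Gen
  | GenAdj
  | Scal of K
  | Add of star_poly K & star_poly K
  | Mul of star_poly K & star_poly K.
Arguments Gen {K}.
Arguments GenAdj {K}.

Section Cumulants.
Context {R : realType} {H : hilbertSpace R}.
Variables (q : R) (e : nat -> H).
Implicit Type X : star_poly R[i].

(* [copy X k] is the operator X^(k); X itself is the operator [copy X 0]. *)
Fixpoint copy X (k : nat) : fock H -> fock H :=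
  match X with
  | Gen => creation (e k)
  | GenAdj => annihilation q (e k)
  | Scal c => fun x => c *: x
  | Add Y Z => fun x => copy Y k x + copy Z k x
  | Mul Y Z => copy Y k \o copy Z k
  end.

Definition rho_part n (p : setpart n) (X : 'I_n -> star_poly R[i]) : R[i] :=
  rho q (\big[(fun f g => f \o g)/id]_(i < n) copy (X i) (block_number p i)).

Definition cumulant_part n (p : setpart n) (X : 'I_n -> star_poly R[i]) : R[i] :=
  \sum_(s : setpart n | (s <= p)%O) rho_part s X * (moebius s p)%:~R.

Definition cumulant n (X : 'I_n -> star_poly R[i]) : R[i] :=
  cumulant_part (setpart1 n) X.

End Cumulants.

Definition star_pow (K : nzRingType) (X : star_poly K) (k : nat) : star_poly K :=
  iter k (Mul X) (Scal 1).

Inductive exponent := Star | Pow of nat.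

Definition Lpow (K : nzRingType) (eps : exponent) : star_poly K :=
  match eps with Star => GenAdj | Pow k => star_pow Gen k end.

Definition weight (eps : exponent) : int :=
  match eps with Star => -1 | Pow k => k%:Z end.

Definition lattice_word n (eps : 'I_n -> exponent) : Prop :=
  let y (j : nat) := \sum_(i < n | (j <= i)%N) weight (eps i) in
  (forall j : nat, (j <= n)%N -> 0 <= y j) /\ y 0%N = 0.

Definition qnum (K : nzRingType) (q : K) (m : nat) : K := \sum_(i < m) q ^+ i.

Definition qfact (K : nzRingType) (q : K) (m : nat) : K :=
  \prod_(i < m) qnum q i.+1.

(* Main.v *)
From HB Require Import structures.
Require Import Defs.
From mathcomp Require Import reals normedtype.
From mathcomp Require Import all_boot all_order all_fingroup all_algebra.
From mathcomp Require Import complex zify.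
From mathcomp Require Import -(notations) monalg.

Set Implicit Arguments.
Unset Strict Implicit.
Unset Printing Implicit Defensive.

Import Order.TTheory GRing.Theory.
Local Open Scope ring_scope.

(** Expanding every annihilation operator writes [rho_part p] as a sum over
    matchings of weights that do not depend on [p]: a matching sends each
    [L^*] to the later power of [L] whose particle it annihilates, and it
    contributes exactly when matched positions lie in the same block of [p],
    that is, when its kernel partition, whose blocks consist of one power and
    the stars matched to it, refines [p]. By Moebius inversion the cumulant of
    index [p] is the sum over the matchings whose kernel is [p]. A kernel with
    a single block leaves room for only one power of [L], in last position and
    preceded by stars; for such words every matching has a one-block kernel,
    so the cumulant is the full expectation. *)

(** * Moebius inversion *)

Section Incidence.
Context {disp : Order.disp_t} {T : finPOrderType disp}.
Implicit Types x y z : T.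

Definition incidence_mx (K : pzRingType) (f : T -> T -> K) : 'M[K]_#|T| :=
  \matrix_(i, j) let x := enum_val i in let y := enum_val j in
                 if (x <= y)%O then f x y else 0.

Lemma mulmx_incidence (K : pzRingType) (f g : T -> T -> K) x y :
  (incidence_mx f *m incidence_mx g) (enum_rank x) (enum_rank y) =
  \sum_(z | (x <= z <= y)%O) f x z * g z y.
Proof.
rewrite mxE [RHS]big_mkcond (reindex _ (onW_bij _ (@enum_val_bij T))) /=.
apply: eq_bigr => k _; rewrite !mxE /= !enum_rankK.
by case: (_ <= _)%O; case: (_ <= _)%O; rewrite ?mulr0 ?mul0r.
Qed.

Lemma moebius_suml x y :
  \sum_(z | (x <= z <= y)%O) moebius x z = (x == y)%:R.
Proof.
have [->|xNy] := eqVneq x y.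
  by rewrite (big_pred1 y) ?moebiusxx // => z; rewrite /= eq_sym eq_le.
have [le_xy|nle_xy] := boolP (x <= y)%O.
  by apply: moebius_sum; rewrite lt_neqAle xNy.
rewrite big_pred0 // => z; apply/negbTE; apply: contra nle_xy => /andP[].
exact: le_trans.
Qed.

(* A left inverse of a square matrix is also a right inverse. *)
Lemma moebius_sumr x y :
  \sum_(z | (x <= z <= y)%O) moebius z y = (x == y)%:R.
Proof.
pose zeta x y : int := 1.
have moebius_zeta : incidence_mx moebius *m incidence_mx zeta = 1%:M.
  apply/matrixP => i j; rewrite -(enum_valK i) -(enum_valK j) mulmx_incidence.
  rewrite mxE (inj_eq enum_rank_inj) -moebius_suml.
  by apply: eq_bigr => z _; rewrite mulr1.
have /matrixP/(_ (enum_rank x) (enum_rank y)) := mulmx1C moebius_zeta.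
rewrite mulmx_incidence mxE (inj_eq enum_rank_inj) => <-.
by apply: eq_bigr => z _; rewrite mul1r.
Qed.

Lemma moebius_inversion (V : zmodType) (f g : T -> V) :
  (forall y, g y = \sum_(x | (x <= y)%O) f x) ->
  forall y, \sum_(x | (x <= y)%O) g x *~ moebius x y = f y.
Proof.
move=> gE y; have fiber z :
    \sum_(x | (x <= y)%O && (z <= x)%O) f z *~ moebius x y = f z *~ (z == y)%:R.
  by under eq_bigl do rewrite andbC; rewrite -mulrz_sumr moebius_sumr.
under eq_bigr do rewrite gE mulrz_suml.
rewrite (exchange_big_dep (fun z => (z <= y)%O)) /=; last first.
  by move=> x z xy zx; exact: le_trans zx xy.
rewrite (bigD1 y) //= fiber eqxx big1 ?addr0 // => z /andP[_ /negbTE zNy].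
by rewrite fiber zNy.
Qed.

End Incidence.

(** * Set partitions *)

Section SetPartition.
Context {n : nat}.
Implicit Types (s p : setpart n) (i j : 'I_n).

Definition same_block p i j : bool := pblock (val p) i == pblock (val p) j.

Lemma mem_cover_setpart p i : i \in cover (val p).
Proof. by have /and3P[/eqP -> _ _] := valP p; rewrite inE. Qed.

Lemma mem_pblock_setpart p i j : (j \in pblock (val p) i) = same_block p i j.
Proof.
have /and3P[_ p_triv _] := valP p.
by rewrite /same_block eq_pblock ?mem_cover_setpart.
Qed.

Lemma setpart_blockP p (A : {set 'I_n}) :
  reflect (exists i, A = pblock (val p) i) (A \in val p).
Proof.
have /and3P[_ p_triv set0Np] := valP p.
apply: (iffP idP) => [Ap|[i ->]]; last by rewrite pblock_mem ?mem_cover_setpart.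
have /set0Pn[i iA] : A != set0 by apply: contraNneq set0Np => <-.
by exists i; rewrite (def_pblock p_triv Ap iA).
Qed.

Lemma le_setpartP s p :
  reflect (forall i j, same_block s i j -> same_block p i j) (s <= p)%O.
Proof.
apply: (iffP (refinesP s p)) => [sp i j|sp _ /setpart_blockP[i ->]].
  have [|_ /setpart_blockP[k ->] /subsetP sk] := sp (pblock (val s) i).
    by apply/setpart_blockP; exists i.
  rewrite -mem_pblock_setpart => /sk; rewrite mem_pblock_setpart => /eqP kj.
  have /sk : i \in pblock (val s) i by rewrite mem_pblock_setpart /same_block.
  by rewrite mem_pblock_setpart /same_block kj eq_sym.
exists (pblock (val p) i); first by apply/setpart_blockP; exists i.
by apply/subsetP => j; rewrite !mem_pblock_setpart; exact: sp.
Qed.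

Lemma eq_block_number p i j :
  (block_number p i == block_number p j) = same_block p i j.
Proof.
have mem k : pblock (val p) k \in enum (val p).
  by rewrite mem_enum; apply/setpart_blockP; exists k.
apply/eqP/eqP => [[]|]; last by rewrite /block_number => ->.
by move/(congr1 (nth set0 (enum (val p)))); rewrite !nth_index.
Qed.

Definition kernel_part (T : finType) (f : 'I_n -> T) : setpart n :=
  exist (fun P => is_true (partition P [set: 'I_n]))
    (preim_partition f [set: 'I_n]) (preim_partitionP _ _).

Lemma same_block_kernel_part (T : finType) (f : 'I_n -> T) i j :
  same_block (kernel_part f) i j = (f i == f j).
Proof.
rewrite -mem_pblock_setpart /= pblock_equivalence_partition ?inE //.
by split=> // /eqP->.
Qed.

Lemma same_block_setpart1 i j : same_block (setpart1 n) i j.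
Proof.
rewrite [setpart1 n](_ : _ = kernel_part (fun=> tt)) //.
by rewrite same_block_kernel_part.
Qed.

Lemma kernel_part_le (f : 'I_n -> 'I_n) p : (forall i, f (f i) = f i) ->
  (kernel_part f <= p)%O = [forall i, same_block p i (f i)].
Proof.
move=> f_idem; apply/le_setpartP/forallP => [kp i|fp i j].
  by apply: kp; rewrite same_block_kernel_part f_idem.
rewrite same_block_kernel_part => /eqP fij.
by rewrite /same_block (eqP (fp i)) fij -(eqP (fp j)).
Qed.

Lemma kernel_part_eq1 (T : finType) (f : 'I_n -> T) :
  reflect (forall i j, f i = f j) (kernel_part f == setpart1 n).
Proof.
apply: (iffP eqP) => [f1 i j|f_const].
  by apply/eqP; rewrite -same_block_kernel_part f1 same_block_setpart1.
apply/le_anti/andP; split; apply/le_setpartP => i j _.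
  exact: same_block_setpart1.
by rewrite same_block_kernel_part (f_const i j).
Qed.

End SetPartition.

(** * Diagrams of annihilations *)

Definition is_pow (x : exponent) : bool := if x is Pow _ then true else false.

(* A term in the expansion of a word of operators applied to the vacuum:
   [partner] sends a star to the position of the power that created the particle
   it annihilates and fixes the other positions, [survivors] lists the positions
   of origin of the remaining particles, and [jumps] is the exponent of [q]. *)
Record diagram (I : finType) :=
  Diagram { partner : {ffun I -> I}; jumps : nat; survivors : seq I }.

Section Diagrams.
Context {I : finType}.
Implicit Types (d : diagram I) (r : seq I) (i j k : I).

Definition diagram_tuple d := (partner d, jumps d, survivors d).

Lemma diagram_tupleK :
  cancel diagram_tuple (fun t => Diagram t.1.1 t.1.2 t.2).
Proof. by case. Qed.

HB.instance Definition _ := Equality.copy (diagram I) (can_type diagram_tupleK).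

Definition create i m d : diagram I :=
  Diagram (partner d) (jumps d) (nseq m i ++ survivors d).

Definition annihilate i d (j : nat) : diagram I :=
  Diagram [ffun k => if k == i then nth i (survivors d) j else partner d k]
    (jumps d + j) (take j (survivors d) ++ drop j.+1 (survivors d)).

Variable eps : I -> exponent.

Definition extend i d : seq (diagram I) :=
  if eps i is Pow m then [:: create i m d]
  else mkseq (annihilate i d) (size (survivors d)).

Fixpoint diagrams r : seq (diagram I) :=
  if r is i :: r' then flatten [seq extend i d | d <- diagrams r']
  else [:: Diagram [ffun i => i] 0 [::]].

Variant extend_spec i d : diagram I -> Prop :=
  | ExtendCreate m of eps i = Pow m : extend_spec i d (create i m d)
  | ExtendAnnihilate (j : nat) of eps i = Star & (j < size (survivors d))%N :
      extend_spec i d (annihilate i d j).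

Lemma extendP i d d' : d' \in extend i d -> extend_spec i d d'.
Proof.
rewrite /extend; case epsi: (eps i) => [|m].
  by case/mapP=> j; rewrite mem_iota => jd ->; constructor.
by rewrite inE => /eqP ->; constructor.
Qed.

Lemma partner_id r d i :
  d \in diagrams r -> is_pow (eps i) || (i \notin r) -> partner d i = i.
Proof.
elim: r d => [|k r IHr] d' /=.
  by rewrite inE => /eqP -> _ /=; rewrite ffunE.
case/flatten_mapP=> d /IHr{IHr} d_id /extendP[m _|j epsk _] /=.
  rewrite inE negb_or => /orP[ip|/andP[_ ir]]; apply: d_id.
    by rewrite ip.
  by rewrite ir orbT.
rewrite ffunE inE; case: eqP => [->|_]; first by rewrite epsk.
exact: d_id.
Qed.

Lemma survivors_pow r d i :
  d \in diagrams r -> i \in survivors d -> is_pow (eps i) && (i \in r).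
Proof.
elim: r d => [|k r IHr] d' /=; first by rewrite inE => /eqP ->.
case/flatten_mapP=> d /IHr{IHr} d_r /extendP[m epsk|j _ _] /=.
  rewrite mem_cat mem_nseq inE => /orP[/andP[_ /eqP->]|/d_r/andP[-> ->]].
    by rewrite epsk eqxx.
  by rewrite orbT.
rewrite mem_cat inE => id'; have /d_r/andP[-> ->] : i \in survivors d.
  by case/orP: id' => [/mem_take|/mem_drop].
by rewrite orbT.
Qed.

Lemma partner_star (lt : rel I) r d i :
    pairwise lt r -> d \in diagrams r -> i \in r -> ~~ is_pow (eps i) ->
  is_pow (eps (partner d i)) && lt i (partner d i).
Proof.
elim: r d => //= k r IHr d' /andP[/allP k_lt lt_r].
case/flatten_mapP=> d dr /extendP[m epsk|j _ j_lt] /=; rewrite inE.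
  by case: eqP => [->|_ /=]; [rewrite epsk|exact: IHr].
rewrite ffunE; case: eqP => [->|_ /=]; last exact: IHr.
by have /(survivors_pow dr)/andP[-> /k_lt ->] := mem_nth k j_lt.
Qed.

Definition monochromatic (c : I -> nat) d : bool :=
  [forall i, c i == c (partner d i)].

Lemma monochromatic_create c i m d :
  monochromatic c (create i m d) = monochromatic c d.
Proof. by []. Qed.

Lemma monochromatic_annihilate (c : I -> nat) i d (j : nat) : partner d i = i ->
  monochromatic c (annihilate i d j) =
  monochromatic c d && (c i == c (nth i (survivors d) j)).
Proof.
move=> di; apply/forallP/andP => [c_d'|[/forallP c_d cij] k]; last first.
  by rewrite ffunE; case: (k =P i) => [->|].
split; last by have := c_d' i; rewrite ffunE eqxx.
apply/forallP => k; have := c_d' k; rewrite ffunE.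
by case: (k =P i) => // ->; rewrite di.
Qed.

End Diagrams.

(** * Star matchings *)

Definition star_matching n (eps : 'I_n -> exponent) (f : 'I_n -> 'I_n) : Prop :=
  forall i, if is_pow (eps i) then f i = i
            else is_pow (eps (f i)) && (i < f i)%N.

Definition extremal_word n (eps : 'I_n -> exponent) : Prop :=
  (forall i : 'I_n, (i < n.-1)%N -> eps i = Star) /\
  (forall i : 'I_n, nat_of_ord i = n.-1 -> eps i = Pow n.-1).

Lemma star_matching_idem n (eps : 'I_n -> exponent) f :
  star_matching eps f -> forall i, f (f i) = f i.
Proof.
move=> f_matching i; have := f_matching i.
case: ifP => [_ fi|_ /andP[pow_fi _]].
  by rewrite !fi.
by have := f_matching (f i); rewrite pow_fi.
Qed.

Lemma star_matching_last_pow n (eps : 'I_n.+1 -> exponent) f :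
  star_matching eps f -> is_pow (eps ord_max).
Proof.
move/(_ ord_max); case: ifP => // _ /andP[_].
by rewrite ltnNge -ltnS ltn_ord.
Qed.

Lemma extremal_star_matching n (eps : 'I_n.+1 -> exponent) f :
  extremal_word eps -> star_matching eps f -> forall i, f i = ord_max.
Proof.
move=> [eps_star eps_pow] f_matching.
have pow_last i : is_pow (eps i) -> i = ord_max.
  move=> pow_i; apply/val_inj/eqP; rewrite eqn_leq -ltnS ltn_ord leqNgt /=.
  by apply: contraL pow_i => /eps_star ->.
move=> i; have := f_matching i; case: ifP => [/pow_last -> //|_ /andP[]].
by move/pow_last.
Qed.

Lemma constant_matching_extremal n (eps : 'I_n.+1 -> exponent) f :
  star_matching eps f -> (forall i j, f i = f j) ->
  \sum_i weight (eps i) = 0 -> extremal_word eps.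
Proof.
move=> f_matching f_const weight0.
have pow_last := star_matching_last_pow f_matching.
have f_last i : f i = ord_max.
  by rewrite (f_const i ord_max); have := f_matching ord_max; rewrite pow_last.
have eps_star (i : 'I_n.+1) : (i < n)%N -> eps i = Star.
  move=> i_lt; have := f_matching i; rewrite f_last.
  case: (eps i) => // k /= i_n.
  by rewrite -i_n ltnn in i_lt.
split=> // i i_n; have -> : i = ord_max by apply: val_inj.
move: weight0; rewrite big_ord_recr /=.
rewrite (eq_bigr (fun=> -1)) => [|j _]; last by rewrite eps_star /=.
case: (eps ord_max) pow_last => // k _ /=.
rewrite sumr_const card_ord mulNrn natz addrC => /eqP.
by rewrite subr_eq0 => /eqP[->].
Qed.

Lemma diagrams_star_matching n (eps : 'I_n -> exponent) d :
  d \in diagrams eps (enum 'I_n) -> star_matching eps (partner d).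
Proof.
have enum_lt : pairwise (fun i j : 'I_n => (i < j)%N) (enum 'I_n).
  rewrite -(pairwise_map val ltn) val_enum_ord -sorted_pairwise.
    exact: iota_ltn_sorted.
  exact: ltn_trans.
move=> dr i; case: ifPn => ip; first by rewrite (partner_id dr) ?ip.
by apply: (partner_star enum_lt dr) ip; rewrite mem_enum.
Qed.

Lemma monochromatic_block_number n (eps : 'I_n -> exponent) d (p : setpart n) :
  d \in diagrams eps (enum 'I_n) ->
  monochromatic (block_number p) d = (kernel_part (partner d) <= p)%O.
Proof.
move=> /diagrams_star_matching/star_matching_idem f_idem.
rewrite kernel_part_le //; apply: eq_forallb => i.
exact: eq_block_number.
Qed.

(** * Vacuum expectations *)

Lemma inversions1 n : inversions (1 : 'S_n)%g = 0%N.
Proof. by apply: eq_card0 => -[i j]; rewrite !inE !perm1; case: ltngtP. Qed.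

Lemma qfact_recr (K : comNzRingType) (q : K) m :
  qfact q m.+1 = qnum q m.+1 * qfact q m.
Proof. by rewrite /qfact big_ord_recr mulrC. Qed.

Lemma iter_linearZ (K : pzRingType) (V : lmodType K) (f : {linear V -> V})
    m a x :
  iter m f (a *: x) = a *: iter m f x.
Proof. by elim: m => //= m ->; rewrite linearZZ. Qed.

Lemma big_comp_foldr (T I : Type) (r : seq I) (F : I -> T -> T) (x : T) :
  (\big[(fun f g => f \o g)/id]_(i <- r) F i) x = foldr F x r.
Proof. by elim: r => [|i r IHr]; rewrite ?big_nil ?big_cons //= IHr. Qed.

Section Fock.
Context (R : realType) (H : hilbertSpace R) (q : R).

Lemma qinner_vacuum_tensor (w : seq H) :
  qinner q vacuum (tensor w) = (nilp w)%:R.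
Proof.
case: w => [|x w]; last by rewrite qinner_tensor0.
rewrite (@qinner_tensor _ _ _ 0) // (bigD1 (1 : 'S_0)%g) //= big_ord0.
rewrite big1 ?addr0 => [|s /eqP[]]; last by apply/permP => -[].
by rewrite inversions1 expr0 mulr1.
Qed.

HB.instance Definition _ (xi : H) :=
  GRing.Linear.copy (annihilation q xi) (lin_ext _).

Lemma annihilation_nseq (xi : H) m :
  annihilation q xi (tensor (nseq m.+1 xi)) =
  (qnum q%:C%C m.+1 * inner xi xi) *: tensor (nseq m xi).
Proof.
rewrite /annihilation lin_ext_tensor size_nseq mulr_suml scaler_suml.
apply: eq_bigr => j _; rewrite nth_nseq ltn_ord; congr (_ *: tensor _).
rewrite take_nseq ?drop_nseq -?nseqD; last exact: ltnW.
by congr nseq; have := ltn_ord j; lia.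
Qed.

Lemma iter_annihilation_nseq (xi : H) m :
  iter m (annihilation q xi) (tensor (nseq m xi)) =
  (qfact q%:C%C m * inner xi xi ^+ m) *: vacuum.
Proof.
elim: m => [|m IHm]; first by rewrite /qfact big_ord0 mulr1 scale1r.
rewrite iterSr annihilation_nseq iter_linearZ IHm scalerA; congr (_ *: _).
by rewrite qfact_recr exprS mulrACA.
Qed.

Variable e : nat -> H.

Lemma copy_linear (X : star_poly R[i]) k : linear (copy q e X k).
Proof.
elim: X => [||c|X IHX Y IHY|X IHX Y IHY] a x y /=.
- by rewrite /creation linearP.
- exact: linearP.
- by rewrite scalerDr !scalerA mulrC.
- by rewrite IHX IHY scalerDr addrACA.
- by rewrite IHY IHX.
Qed.

HB.instance Definition _ X k :=
  GRing.isLinear.Build R[i] (fock H) (fock H) _ (copy q e X k)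
    (copy_linear X k).

Lemma copy_star_pow (X : star_poly R[i]) m k x :
  copy q e (star_pow X m) k x = iter m (copy q e X k) x.
Proof. by elim: m => [|m IHm] /=; rewrite ?scale1r ?IHm. Qed.

Lemma copy_gen_pow m k w :
  copy q e (star_pow Gen m) k (tensor w) = tensor (nseq m (e k) ++ w).
Proof.
rewrite copy_star_pow; elim: m => // m IHm.
by rewrite iterS IHm /= /creation lin_ext_tensor.
Qed.

Lemma rho_star_pow m k :
  rho q (copy q e (Mul (star_pow GenAdj m) (star_pow Gen m)) k) =
  qfact q%:C%C m * inner (e k) (e k) ^+ m.
Proof.
rewrite /rho [copy _ _ (Mul _ _) _ _]/= copy_gen_pow cats0 copy_star_pow.
by rewrite iter_annihilation_nseq qinnerZr qinner_vacuum_tensor mulr1.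
Qed.

Lemma rho_part_foldr n (p : setpart n) (X : 'I_n -> star_poly R[i]) :
  rho_part q e p X =
  qinner q vacuum
    (foldr (fun i => copy q e (X i) (block_number p i)) vacuum (enum 'I_n)).
Proof. by rewrite -big_comp_foldr enumT. Qed.

Lemma rho_part_extremal n (eps : 'I_n.+1 -> exponent) : extremal_word eps ->
  rho_part q e (setpart1 n.+1) (fun i => Lpow R[i] (eps i)) =
  rho q (copy q e (Mul (star_pow GenAdj n) (star_pow Gen n))
           (block_number (setpart1 n.+1) ord_max)).
Proof.
move=> [eps_star eps_pow]; rewrite rho_part_foldr /rho; congr qinner.
set k := block_number (setpart1 n.+1) ord_max.
have block_number_const i : block_number (setpart1 n.+1) i = k.
  by apply/eqP; rewrite eq_block_number same_block_setpart1.
rewrite enum_ordSr foldr_rcons foldr_map eps_pow //= [RHS]copy_star_pow.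
move: (copy _ _ _ _ _) => x; rewrite -[in RHS](size_enum_ord n).
elim: (enum 'I_n) => //= j s ->.
by rewrite block_number_const eps_star ?(ltn_ord j).
Qed.

(** * Expansion over diagrams *)

Hypothesis e_orth : forall i j, inner (e i) (e j) = (i == j)%:R.

Section Expansion.
Variables (I : finType) (eps : I -> exponent) (c : I -> nat).

Definition diagram_term (d : diagram I) : fock H :=
  if monochromatic c d
  then q%:C%C ^+ jumps d *: tensor [seq e (c i) | i <- survivors d] else 0.

Lemma annihilation_colored (i0 : I) k (w : seq I) :
  annihilation q (e k) (tensor [seq e (c i) | i <- w]) =
  \sum_(0 <= j < size w | k == c (nth i0 w j))
    q%:C%C ^+ j *: tensor [seq e (c i) | i <- take j w ++ drop j.+1 w].
Proof.
rewrite /annihilation lin_ext_tensor size_map big_mkord [RHS]big_mkcond /=.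
apply: eq_bigr => j _; rewrite (nth_map i0) // e_orth map_cat map_take map_drop.
by case: eqP; rewrite ?mulr1 // mulr0 scale0r.
Qed.

Lemma copy_extend i d : partner d i = i ->
  copy q e (Lpow R[i] (eps i)) (c i) (diagram_term d) =
  \sum_(d' <- extend eps i d) diagram_term d'.
Proof.
move=> di; rewrite /diagram_term.
have [c_d|/negbTE c_Nd] := boolP (monochromatic c d); last first.
  rewrite linear0 big1_seq // => _ /andP[_ /extendP[m _|j _ _]].
    by rewrite monochromatic_create c_Nd.
  by rewrite monochromatic_annihilate // c_Nd.
rewrite linearZZ /extend; case: (eps i) => [|m] /=; last first.
  by rewrite big_seq1 monochromatic_create c_d copy_gen_pow map_cat map_nseq.
rewrite (annihilation_colored i) scaler_sumr big_map /index_iota subn0.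
rewrite big_mkcond; apply: eq_bigr => j _.
by rewrite monochromatic_annihilate // c_d /= exprD scalerA.
Qed.

Lemma foldr_copy_diagrams r : uniq r ->
  foldr (fun i => copy q e (Lpow R[i] (eps i)) (c i)) vacuum r =
  \sum_(d <- diagrams eps r) diagram_term d.
Proof.
elim: r => [_|i r IHr /= /andP[iNr /IHr ->]] /=.
  rewrite big_seq1 /diagram_term scale1r ifT //.
  by apply/forallP => i; rewrite ffunE.
rewrite big_flatten big_map linear_sum big_seq [RHS]big_seq.
apply: eq_bigr => d dr; apply: copy_extend.
by rewrite (partner_id dr) // iNr orbT.
Qed.

End Expansion.

Section Cumulants.
Variables (n : nat) (eps : 'I_n -> exponent).

Definition closed_diagrams : seq (diagram 'I_n) :=
  [seq d <- diagrams eps (enum 'I_n) | nilp (survivors d)].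

Lemma closed_diagrams_star_matching d :
  d \in closed_diagrams -> star_matching eps (partner d).
Proof. by rewrite mem_filter => /andP[_ /diagrams_star_matching]. Qed.

Lemma rho_part_diagrams p :
  rho_part q e p (fun i => Lpow R[i] (eps i)) =
  \sum_(d <- closed_diagrams | (kernel_part (partner d) <= p)%O)
    q%:C%C ^+ jumps d.
Proof.
rewrite rho_part_foldr foldr_copy_diagrams ?enum_uniq // qinner_sumr.
rewrite big_filter_cond big_seq [RHS]big_mkcond [RHS]big_seq.
apply: eq_bigr => d dr; rewrite -(monochromatic_block_number _ dr).
rewrite /diagram_term; case: monochromatic; last by rewrite andbF linear0.
rewrite andbT qinnerZr qinner_vacuum_tensor /nilp size_map.
by case: ifP; rewrite ?mulr1 ?mulr0.
Qed.

Lemma cumulant_part_diagrams p :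
  cumulant_part q e p (fun i => Lpow R[i] (eps i)) =
  \sum_(d <- closed_diagrams | kernel_part (partner d) == p) q%:C%C ^+ jumps d.
Proof.
rewrite /cumulant_part; under eq_bigr do rewrite mulrzr.
pose kernel_sum s : R[i] :=
  \sum_(d <- closed_diagrams | kernel_part (partner d) == s) q%:C%C ^+ jumps d.
apply: (moebius_inversion (f := kernel_sum)).
move=> s; rewrite rho_part_diagrams.
rewrite (partition_big (fun d => kernel_part (partner d)) (<= s)%O) //=.
apply: eq_bigr => t ts; apply: eq_bigl => d.
by case: eqP => [->|]; rewrite ?ts ?andbF.
Qed.

End Cumulants.

Lemma cumulant_not_extremal n (eps : 'I_n.+1 -> exponent) :
    \sum_i weight (eps i) = 0 -> ~ extremal_word eps ->
  cumulant q e (fun i => Lpow R[i] (eps i)) = 0.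
Proof.
move=> weight0 not_extremal; rewrite /cumulant cumulant_part_diagrams.
rewrite big_seq_cond big1 // => d.
case/andP=> /closed_diagrams_star_matching d_matching /kernel_part_eq1 d_const.
case: not_extremal.
exact: constant_matching_extremal d_matching d_const weight0.
Qed.

Lemma cumulant_extremal n (eps : 'I_n.+1 -> exponent) : extremal_word eps ->
  cumulant q e (fun i => Lpow R[i] (eps i)) =
  rho_part q e (setpart1 n.+1) (fun i => Lpow R[i] (eps i)).
Proof.
move=> extremal; rewrite /cumulant cumulant_part_diagrams rho_part_diagrams.
rewrite big_seq_cond [RHS]big_seq_cond; apply: eq_bigl => d.
apply: andb_id2l => /closed_diagrams_star_matching.
move=> /(extremal_star_matching extremal) d_last.
have /kernel_part_eq1/eqP -> : forall i j, partner d i = partner d j.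
  by move=> i j; rewrite !d_last.
by rewrite eqxx lexx.
Qed.

End Fock.

Theorem mainTheorem8 (R : realType) (q : R) (hq : -1 <= q <= 1)
    (H : hilbertSpace R) (e : nat -> H) (he : orthonormal_basis e)
    (n : nat) (hn : (0 < n)%N) (eps : 'I_n -> exponent)
    (heps : lattice_word eps) :
  let L : star_poly R[i] := Gen in
  let Lstar : star_poly R[i] := GenAdj in
  let extremal :=
    (forall i : 'I_n, (i < n.-1)%N -> eps i = Star) /\
    (forall i : 'I_n, nat_of_ord i = n.-1 -> eps i = Pow n.-1) in
  (~ extremal -> cumulant q e (fun i => Lpow R[i] (eps i)) = 0) /\
  (extremal ->
    cumulant q e (fun i => Lpow R[i] (eps i)) =
      rho q (copy q e (Mul (star_pow Lstar n.-1) (star_pow L n.-1)) 0) /\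
    rho q (copy q e (Mul (star_pow Lstar n.-1) (star_pow L n.-1)) 0) =
      qfact (q%:C)%C n.-1).
Proof.
have [e_orth _] := he; have [_ weight0] := heps.
case: n hn eps heps weight0 => // m _ eps heps weight0 L Lstar extremal.
have rhoE k : rho q (copy q e (Mul (star_pow Lstar m) (star_pow L m)) k) =
    qfact q%:C%C m.
  by rewrite rho_star_pow e_orth eqxx expr1n mulr1.
split=> [not_extremal|is_extremal].
  exact: cumulant_not_extremal weight0 not_extremal.
split; last exact: rhoE.
rewrite (cumulant_extremal q e_orth is_extremal).
by rewrite (rho_part_extremal q e is_extremal) !rhoE.
Qed.
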